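(* Let $n\ge2$, $\mathfrak u=\mathfrak u_{r,s}(\mathfrak{so}_{2n+1})$ as in the context, and $\mathfrak b$ its Hopf subalgebra generated by $e_i,\omega_i^{\pm1}$ $(1\le i\le n)$. With $t=\prod_{i=1}^n(1+\omega_i+\cdots+\omega_i^{\ell-1})$ and $x=\widehat{\mathcal E}_1\cdots\widehat{\mathcal E}_n$, where $\widehat{\mathcal E}_i=\mathcal E_{i,i}^{\ell-1}\mathcal E_{i,i+1}^{\ell-1}\cdots\mathcal E_{i,n}^{\ell-1}\mathcal E_{i,n'}^{\ell-1}\mathcal E_{i,(n-1)'}^{\ell-1}\cdots\mathcal E_{i,(i+1)'}^{\ell-1}$ $(1\le i<n)$ and $\widehat{\mathcal E}_n=\mathcal E_{n,n}^{\ell-1}$, the element $y'=xt$ is a right integral in $\mathfrak b$, i.e. $y'b=\varepsilon(b)y'$ for all $b\in\mathfrak b$.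
   Context: Standing setting: $r$ a primitive $d$-th and $s$ a primitive $d'$-th root of unity, $r^3\ne s^3$, $r^4\ne s^4$, $\ell=\mathrm{lcm}(d,d')$ odd, $\mathbb K=\mathbb Q(r,s)$. $U_{r,s}(\mathfrak{so}_{2n+1})$ is generated by $e_i,f_i,\omega_i^{\pm1},\omega_i'^{\pm1}$ ($1\le i\le n$) with: $\omega$'s commute, invertible; $\omega_je_i\omega_j^{-1}=\langle\omega_i',\omega_j\rangle e_i$, $\omega_jf_i\omega_j^{-1}=\langle\omega_i',\omega_j\rangle^{-1}f_i$, $\omega_j'e_i\omega_j'^{-1}=\langle\omega_j',\omega_i\rangle^{-1}e_i$, $\omega_j'f_i\omega_j'^{-1}=\langle\omega_j',\omega_i\rangle f_i$, where $\langle\omega_i',\omega_i\rangle=r^2s^{-2}$ ($i<n$), $\langle\omega_n',\omega_n\rangle=rs^{-1}$, $\langle\omega_i',\omega_{i+1}\rangle=r^{-2}$, $\langle\omega_{i+1}',\omega_i\rangle=s^2$, others $1$; $e_if_j-f_je_i=\delta_{ij}(\omega_i-\omega_i')/(r_i-s_i)$ ($r_i=r^2,s_i=s^2$ for $i<n$; $r_n=r,s_n=s$); Serre relations $(\mathrm{ad}_le_i)^{1-a_{ij}}(e_j)=0=(\mathrm{ad}_rf_i)^{1-a_{ij}}(f_j)$, $i\ne j$, $(a_{ij})$ the $B_n$ Cartan matrix ($a_{n,n-1}=-2$, $a_{n-1,n}=-1$). Hopf structure: $\omega$'s group-like, $\Delta(e_i)=e_i\otimes1+\omega_i\otimes e_i$,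 $\Delta(f_i)=1\otimes f_i+f_i\otimes\omega_i'$, $\varepsilon(e_i)=0$, $\varepsilon(\omega_i)=1$, $S(e_i)=-\omega_i^{-1}e_i$, $S(f_i)=-f_i\omega_i'^{-1}$. Root vectors $\mathcal E_{i,i}=e_i$, $\mathcal E_{i,j}=e_i\mathcal E_{i+1,j}-r^2\mathcal E_{i+1,j}e_i$ ($i<j\le n$), $\mathcal E_{i,n'}=\mathcal E_{i,n}e_n-rs\,e_n\mathcal E_{i,n}$, $\mathcal E_{i,j'}=\mathcal E_{i,(j+1)'}e_j-s^{-2}e_j\mathcal E_{i,(j+1)'}$ ($i<j<n$); $\mathcal F_{i,i}=f_i$, $\mathcal F_{i,j}=\mathcal F_{i+1,j}f_i-s^2f_i\mathcal F_{i+1,j}$, $\mathcal F_{i,n'}=f_n\mathcal F_{i,n}-rs\,\mathcal F_{i,n}f_n$, $\mathcal F_{i,j'}=f_j\mathcal F_{i,(j+1)'}-r^{-2}\mathcal F_{i,(j+1)'}f_j$. $\mathfrak u_{r,s}(\mathfrak{so}_{2n+1})$ is the quotient Hopf algebra of $U_{r,s}(\mathfrak{so}_{2n+1})$ by the ideal generated by all $\mathcal E_{k,j}^\ell,\mathcal E_{k,j'}^\ell,\mathcal F_{k,j}^\ell,\mathcal F_{k,j'}^\ell,\omega_k^\ell-1,(\omega_k')^\ell-1$. *)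

(* Defs.v *)
From HB Require Import structures.
From mathcomp Require Import all_boot all_order all_algebra all_field.
Set Implicit Arguments. Unset Strict Implicit. Unset Printing Implicit Defensive.
Import GRing.Theory.
Local Open Scope ring_scope.

(* Generators of U_{r,s}(so_{2n+1}); indices are 'I_n (0-based internally). *)
Inductive kind := KE | KF | KW | KWi | KWp | KWpi.
(* KE = e_i, KF = f_i, KW = omega_i, KWi = omega_i^{-1},
   KWp = omega'_i, KWpi = omega'_i^{-1} *)

Inductive term (K : Type) (n : nat) : Type :=
| tgen of kind & 'I_n
| tsc of K
| tadd of term K n & term K n
| tmul of term K n & term K n.

Arguments tsc {K n}.

Section Presentation.
Variables (K : fieldType) (n : nat) (r s : K) (l : nat).

Local Notation T := (term K n).

Definition tscale (c : K) (a : T) : T := tmul (tsc c) a.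
Definition tsub (a b : T) : T := tadd a (tscale (-1) b).
Fixpoint tpow (a : T) (k : nat) : T :=
  if k is k'.+1 then tmul a (tpow a k') else tsc 1.
Definition tprod (xs : seq T) : T := foldr (@tmul K n) (tsc 1) xs.
Definition tsum (xs : seq T) : T := foldr (@tadd K n) (tsc 0) xs.

(* generator with 1-based nat index i (1 <= i <= n); only used in range *)
Definition gen1 (k : kind) (i : nat) : T :=
  if @insub nat (fun m => m < n)%N 'I_n i.-1 is Some j then @tgen K n k j else tsc 0.
Definition e i := gen1 KE i.
Definition f i := gen1 KF i.
Definition w i := gen1 KW i.
Definition wi i := gen1 KWi i.
Definition wp i := gen1 KWp i.
Definition wpi i := gen1 KWpi i.

(* <omega'_i, omega_j>, 1-based *)
Definition pair_ij (i j : nat) : K :=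
  if i == j then (if i == n then r / s else r ^+ 2 / s ^+ 2)
  else if j == i.+1 then (r ^+ 2)^-1
  else if i == j.+1 then s ^+ 2
  else 1.

Definition ri (i : nat) : K := if i == n then r else r ^+ 2.
Definition si (i : nat) : K := if i == n then s else s ^+ 2.

(* B_n Cartan matrix entries (1-based): 1 - a_ij for i <> j *)
Definition serre_exp (i j : nat) : nat :=
  if (i == n) && (j == n.-1) then 3
  else if (j == i.+1) || (i == j.+1) then 2 else 1.

(* left adjoint action of e_i and right adjoint action of f_i, computed from
   the Hopf structure: ad_l(a)(b) = a_(1) b S(a_(2)),
   ad_r(a)(b) = S(a_(1)) b a_(2). *)
Definition adl_e (i : nat) (b : T) : T :=
  tsub (tmul (e i) b) (tmul (tmul (tmul (w i) b) (wi i)) (e i)).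
Definition adr_f (i : nat) (b : T) : T :=
  tsub (tmul b (f i)) (tmul (tmul (tmul (f i) (wpi i)) b) (wp i)).

(* Root vectors, 1-based.  Eij i j = E_{i,j} (i <= j <= n);
   Epr i j = E_{i,j'} (i < j <= n). *)
Fixpoint Eij_aux (k i : nat) : T :=
  if k is k'.+1 then
    tsub (tmul (e i) (Eij_aux k' i.+1)) (tmul (tscale (r ^+ 2) (Eij_aux k' i.+1)) (e i))
  else e i.
Definition Eij (i j : nat) : T := Eij_aux (j - i) i.
Fixpoint Epr_aux (k i : nat) : T :=
  if k is k'.+1 then
    tsub (tmul (Epr_aux k' i) (e (n - k)))
         (tmul (tscale (s ^- 2) (e (n - k))) (Epr_aux k' i))
  else tsub (tmul (Eij i n) (e n)) (tmul (tscale (r * s) (e n)) (Eij i n)).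
Definition Epr (i j : nat) : T := Epr_aux (n - j) i.

Fixpoint Fij_aux (k i : nat) : T :=
  if k is k'.+1 then
    tsub (tmul (Fij_aux k' i.+1) (f i)) (tmul (tscale (s ^+ 2) (f i)) (Fij_aux k' i.+1))
  else f i.
Definition Fij (i j : nat) : T := Fij_aux (j - i) i.
Fixpoint Fpr_aux (k i : nat) : T :=
  if k is k'.+1 then
    tsub (tmul (f (n - k)) (Fpr_aux k' i))
         (tmul (tscale (r ^- 2) (Fpr_aux k' i)) (f (n - k)))
  else tsub (tmul (f n) (Fij i n)) (tmul (tscale (r * s) (Fij i n)) (f n)).
Definition Fpr (i j : nat) : T := Fpr_aux (n - j) i.

Definition inrange (i : nat) := (1 <= i <= n)%N.

Inductive defrel : T -> T -> Prop :=
| R_wwi i : inrange i -> defrel (tmul (w i) (wi i)) (tsc 1)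
| R_wiw i : inrange i -> defrel (tmul (wi i) (w i)) (tsc 1)
| R_wpwpi i : inrange i -> defrel (tmul (wp i) (wpi i)) (tsc 1)
| R_wpiwp i : inrange i -> defrel (tmul (wpi i) (wp i)) (tsc 1)
| R_ww i j : inrange i -> inrange j -> defrel (tmul (w i) (w j)) (tmul (w j) (w i))
| R_wwp i j : inrange i -> inrange j -> defrel (tmul (w i) (wp j)) (tmul (wp j) (w i))
| R_wpwp i j : inrange i -> inrange j -> defrel (tmul (wp i) (wp j)) (tmul (wp j) (wp i))
| R_we i j : inrange i -> inrange j ->
    defrel (tmul (tmul (w j) (e i)) (wi j)) (tscale (pair_ij i j) (e i))
| R_wf i j : inrange i -> inrange j ->
    defrel (tmul (tmul (w j) (f i)) (wi j)) (tscale (pair_ij i j)^-1 (f i))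
| R_wpe i j : inrange i -> inrange j ->
    defrel (tmul (tmul (wp j) (e i)) (wpi j)) (tscale (pair_ij j i)^-1 (e i))
| R_wpf i j : inrange i -> inrange j ->
    defrel (tmul (tmul (wp j) (f i)) (wpi j)) (tscale (pair_ij j i) (f i))
| R_ef i j : inrange i -> inrange j ->
    defrel (tsub (tmul (e i) (f j)) (tmul (f j) (e i)))
           (if i == j then tscale (ri i - si i)^-1 (tsub (w i) (wp i)) else tsc 0)
| R_serre_e i j : inrange i -> inrange j -> i != j ->
    defrel (iter (serre_exp i j) (adl_e i) (e j)) (tsc 0)
| R_serre_f i j : inrange i -> inrange j -> i != j ->
    defrel (iter (serre_exp i j) (adr_f i) (f j)) (tsc 0)
| R_Eij k j : (1 <= k <= j)%N -> (j <= n)%N -> defrel (tpow (Eij k j) l) (tsc 0)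
| R_Epr k j : (1 <= k < j)%N -> (j <= n)%N -> defrel (tpow (Epr k j) l) (tsc 0)
| R_Fij k j : (1 <= k <= j)%N -> (j <= n)%N -> defrel (tpow (Fij k j) l) (tsc 0)
| R_Fpr k j : (1 <= k < j)%N -> (j <= n)%N -> defrel (tpow (Fpr k j) l) (tsc 0)
| R_wl k : inrange k -> defrel (tpow (w k) l) (tsc 1)
| R_wpl k : inrange k -> defrel (tpow (wp k) l) (tsc 1).

Inductive ueq : T -> T -> Prop :=
| ueq_refl a : ueq a a
| ueq_sym a b : ueq a b -> ueq b a
| ueq_trans a b c : ueq a b -> ueq b c -> ueq a c
| ueq_add a a' b b' : ueq a a' -> ueq b b' -> ueq (tadd a b) (tadd a' b')
| ueq_mul a a' b b' : ueq a a' -> ueq b b' -> ueq (tmul a b) (tmul a' b')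
| ueq_addA a b c : ueq (tadd a (tadd b c)) (tadd (tadd a b) c)
| ueq_addC a b : ueq (tadd a b) (tadd b a)
| ueq_add0 a : ueq (tadd (tsc 0) a) a
| ueq_addN a : ueq (tadd a (tscale (-1) a)) (tsc 0)
| ueq_mulA a b c : ueq (tmul a (tmul b c)) (tmul (tmul a b) c)
| ueq_mul1l a : ueq (tmul (tsc 1) a) a
| ueq_mul1r a : ueq (tmul a (tsc 1)) a
| ueq_mulDl a b c : ueq (tmul (tadd a b) c) (tadd (tmul a c) (tmul b c))
| ueq_mulDr a b c : ueq (tmul a (tadd b c)) (tadd (tmul a b) (tmul a c))
| ueq_scD x y : ueq (tadd (tsc x) (tsc y)) (tsc (x + y))
| ueq_scM x y : ueq (tmul (tsc x) (tsc y)) (tsc (x * y))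
| ueq_scC x a : ueq (tmul (tsc x) a) (tmul a (tsc x))
| ueq_rel a b : defrel a b -> ueq a b.

Fixpoint eps (a : T) : K :=
  match a with
  | tgen k _ => match k with KE | KF => 0 | _ => 1 end
  | tsc c => c
  | tadd a b => eps a + eps b
  | tmul a b => eps a * eps b
  end.

Fixpoint in_borel (a : T) : bool :=
  match a with
  | tgen k _ => match k with KE | KW | KWi => true | _ => false end
  | tsc _ => true
  | tadd a b => in_borel a && in_borel b
  | tmul a b => in_borel a && in_borel b
  end.

Definition Ehat (i : nat) : T :=
  tmul (tprod [seq tpow (Eij i j) l.-1 | j <- iota i (n - i).+1])
       (tprod [seq tpow (Epr i j) l.-1 | j <- rev (iota i.+1 (n - i))]).

Definition xelt : T := tprod [seq Ehat i | i <- iota 1 n].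
Definition telt : T :=
  tprod [seq tsum [seq tpow (w i) k | k <- iota 0 l] | i <- iota 1 n].
Definition yprime : T := tmul xelt telt.

End Presentation.

(* Main.v *)
Require Import Defs.
From HB Require Import structures.
From mathcomp Require Import all_boot all_order all_algebra all_field.
From mathcomp Require Import generic_quotient boolp ring zify.
Import GRing.Theory.
Local Open Scope ring_scope.

(** The identities [y' w_i = y'] are immediate, and [t e_i = e_i t'] for some
    [t'], so everything reduces to [x e_i = 0].  Let [E_1, E_2, ...] be the root
    vectors in the order in which they occur in [x], and let [J_k] be the right
    ideal generated by the [E_m] with [m < k].  If [E_k J_k] is contained in
    [J_k] for every [k], then [E_1^(l-1) ... E_k^(l-1)] annihilates
    [E_1, ..., E_k], by induction on [k]: for [m < k] the element
    [E_k^(l-1) E_m] stays in [J_k], and [E_k^l = 0] settles [m = k].  This needs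
    neither a PBW basis nor the full straightening relations.

    The root vectors with first index [i] form a chain in which each is a
    q-bracket of its predecessor with some simple [e_j].  Left multiplication by
    [e_j] maps [J_k] into [J_{k+1}] because [e_j] q-commutes with every member of
    the chain except where it is the next step, and the remaining products
    [E_k E_{k-1}] lie in [J_k] because neighbours in the chain q-commute.  Both
    facts follow from the Serre relations by identities in a free algebra; their
    denominators are the factors [r^2 + s^2] and [r^2 + r s + s^2] of
    [r^4 - s^4] and [r^3 - s^3]. *)

(** * Deciding identities in a free associative algebra *)

Inductive nc_expr (K : Type) : Type :=
| NCVar of nat
| NCZero
| NCAdd of nc_expr K & nc_expr K
| NCOpp of nc_expr K
| NCMul of nc_expr K & nc_expr K
| NCScale of K & nc_expr K.

(* The list functions are redefined so that [nc_ring] can unfold exactly these,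
   keeping the coefficients of K in a form that [ring] recognizes. *)
Fixpoint nc_eqb (u v : list nat) : bool :=
  match u, v with
  | nil, nil => true
  | cons a u', cons b v' => if eqn a b then nc_eqb u' v' else false
  | _, _ => false
  end.

Lemma nc_eqbP u v : nc_eqb u v -> u = v.
Proof. by elim: u v => [|a u IH] [|b v] //=; case: eqnP => // -> /IH ->. Qed.

Section NonCommutative.
Variables (K : comNzRingType) (A : algType K).
Implicit Types (env : seq A) (t : nc_expr K) (u v : list nat).
Let nform := list (K * list nat).
Implicit Types p q : nform.

Fixpoint nc_app (T : Type) (a b : list T) : list T :=
  match a with nil => b | cons x a' => cons x (nc_app T a' b) end.

Fixpoint nc_map (f : K * list nat -> K * list nat) p : nform :=
  match p with nil => nil | cons x p' => cons (f x) (nc_map f p') end.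

Fixpoint nc_mul p q : nform :=
  match p with
  | nil => nil
  | cons x p' =>
      nc_app _ (nc_map (fun y => (x.1 * y.1, nc_app _ x.2 y.2)) q) (nc_mul p' q)
  end.

Fixpoint nc_norm t : nform :=
  match t with
  | NCVar i => cons (1, cons i nil) nil
  | NCZero => nil
  | NCAdd a b => nc_app _ (nc_norm a) (nc_norm b)
  | NCOpp a => nc_map (fun y => (- y.1, y.2)) (nc_norm a)
  | NCMul a b => nc_mul (nc_norm a) (nc_norm b)
  | NCScale c a => nc_map (fun y => (c * y.1, y.2)) (nc_norm a)
  end.

Fixpoint nc_insert (c : K) u p : nform :=
  match p with
  | nil => cons (c, u) nil
  | cons x p' =>
      if nc_eqb u x.2 then cons (c + x.1, u) p' else cons x (nc_insert c u p')
  end.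

Fixpoint nc_collect p : nform :=
  match p with nil => nil | cons x p' => nc_insert x.1 x.2 (nc_collect p') end.

Fixpoint nc_null p : Prop :=
  match p with nil => True | cons x p' => x.1 = 0 /\ nc_null p' end.

Fixpoint nc_eval env t : A :=
  match t with
  | NCVar i => nth 0 env i
  | NCZero => 0
  | NCAdd a b => nc_eval env a + nc_eval env b
  | NCOpp a => - nc_eval env a
  | NCMul a b => nc_eval env a * nc_eval env b
  | NCScale c a => c *: nc_eval env a
  end.

Fixpoint word_eval env u : A :=
  match u with nil => 1 | cons i u' => nth 0 env i * word_eval env u' end.

Fixpoint form_eval env p : A :=
  match p with nil => 0 | cons x p' => x.1 *: word_eval env x.2 + form_eval env p' end.

Lemma word_eval_app env u v :
  word_eval env (nc_app _ u v) = word_eval env u * word_eval env v.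
Proof. by elim: u => [|i u IH] /=; rewrite ?mul1r // IH mulrA. Qed.

Lemma form_eval_app env p q :
  form_eval env (nc_app _ p q) = form_eval env p + form_eval env q.
Proof. by elim: p => [|x p IH] /=; rewrite ?add0r // IH addrA. Qed.

Lemma form_eval_mul env p q :
  form_eval env (nc_mul p q) = form_eval env p * form_eval env q.
Proof.
elim: p => [|x p IH] /=; first by rewrite mul0r.
rewrite form_eval_app IH mulrDl; congr (_ + _).
elim: q {IH} => [|y q IH] /=; first by rewrite mulr0.
by rewrite IH mulrDr word_eval_app; congr (_ + _); rewrite -scalerAl -scalerAr scalerA.
Qed.

Lemma form_eval_norm env t : form_eval env (nc_norm t) = nc_eval env t.
Proof.
elim: t => [i||a IHa b IHb|a IH|a IHa b IHb|c a IH] //=.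
- by rewrite scale1r mulr1 addr0.
- by rewrite form_eval_app IHa IHb.
- rewrite -IH; elim: (nc_norm a) => [|x p IHp] /=; first by rewrite oppr0.
  by rewrite IHp scaleNr opprD.
- by rewrite form_eval_mul IHa IHb.
- rewrite -IH; elim: (nc_norm a) => [|x p IHp] /=; first by rewrite scaler0.
  by rewrite IHp -scalerA scalerDr.
Qed.

Lemma form_eval_collect env p : form_eval env (nc_collect p) = form_eval env p.
Proof.
elim: p => //= x p <-; elim: (nc_collect p) => //= y q IH.
case E: nc_eqb => /=; last by rewrite IH addrCA.
by rewrite (nc_eqbP _ _ E) scalerDl addrA.
Qed.

(** Once the difference is grouped by words, it suffices that every coefficient vanishes. A
    noncommutative identity thus becomes a finite list of commutative identities between scalars. *)
Lemma nc_decide env t t' :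
  nc_null (nc_collect (nc_norm (NCAdd _ t (NCOpp _ t')))) ->
  nc_eval env t = nc_eval env t'.
Proof.
move=> H; apply: subr0_eq.
rewrite -[_ - _]/(nc_eval env (NCAdd _ t (NCOpp _ t'))).
rewrite -form_eval_norm -form_eval_collect.
by elim: nc_collect H => //= x p IH [-> /IH ->]; rewrite scale0r addr0.
Qed.

End NonCommutative.

Ltac nc_lookup x env :=
  lazymatch env with
  | cons x _ => constr:(O)
  | cons _ ?env' => let i := nc_lookup x env' in constr:(S i)
  end.

Ltac nc_mem x env :=
  lazymatch env with
  | nil => constr:(false)
  | cons x _ => constr:(true)
  | cons _ ?env' => nc_mem x env'
  end.

Ltac nc_atoms t env :=
  lazymatch t with
  | (?a + ?b)%R => let env1 := nc_atoms a env in nc_atoms b env1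
  | (- ?a)%R => nc_atoms a env
  | (?a * ?b)%R => let env1 := nc_atoms a env in nc_atoms b env1
  | (?c *: ?a)%R => nc_atoms a env
  | (0)%R => env
  | _ => let m := nc_mem t env in
         lazymatch m with true => env | false => constr:(cons t env) end
  end.

Ltac nc_reify K t env :=
  lazymatch t with
  | (?a + ?b)%R =>
      let a' := nc_reify K a env in let b' := nc_reify K b env in
      constr:(NCAdd K a' b')
  | (- ?a)%R => let a' := nc_reify K a env in constr:(NCOpp K a')
  | (?a * ?b)%R =>
      let a' := nc_reify K a env in let b' := nc_reify K b env in
      constr:(NCMul K a' b')
  | (?c *: ?a)%R => let a' := nc_reify K a env in constr:(NCScale K c a')
  | (0)%R => constr:(NCZero K)
  | _ => let i := nc_lookup t env in constr:(NCVar K i)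
  end.

Ltac nc_ring K A :=
  lazymatch goal with
  | |- ?t = ?t' =>
      let env0 := nc_atoms t (@nil (GRing.Algebra.sort A)) in
      let env := nc_atoms t' env0 in
      let e := nc_reify (GRing.ComNzRing.sort K) t env in
      let e' := nc_reify (GRing.ComNzRing.sort K) t' env in
      refine (@nc_decide K A env e e' _);
      cbv [nc_norm nc_collect nc_insert nc_null nc_mul nc_map nc_app nc_eqb
           eqn fst snd];
      repeat split; ring
  end.

(** * Consequences of Serre relations *)

Section Brackets.
Variables (K : fieldType) (A : algType K).
Implicit Types (X a b U : A) (x y r s c : K).

Definition qbr c X a : A := X * a - c *: (a * X).

Local Ltac ncr := nc_ring (K : comNzRingType) A.

Lemma scale_eq0 c X : c != 0 -> c *: X = 0 -> X = 0.
Proof.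
by move=> c0 /(congr1 (GRing.scale c^-1)); rewrite scalerA mulVf // scale1r scaler0.
Qed.

Lemma qbrx0 c X : qbr c X 0 = 0.
Proof. by rewrite /qbr mulr0 mul0r scaler0 subrr. Qed.

(** The two sides differ by terms containing X b - b X. Moving brackets inward in this way
    transports Serre relations between simple generators to longer root vectors. *)
Lemma qbrA c x X a b : GRing.comm X b ->
  qbr c (qbr x X a) b = qbr x X (qbr c a b).
Proof.
rewrite /GRing.comm => Xb; apply: subr0_eq.
transitivity (- (x *: (a * (X * b - b * X))) + c *: ((X * b - b * X) * a)).
  rewrite /qbr; ncr.
by rewrite Xb subrr mulr0 mul0r !scaler0 addr0 oppr0.
Qed.

Lemma qbr_qcomm c x X a b :
  b * X = c *: (X * b) -> GRing.comm a b -> b * qbr x X a = c *: (qbr x X a * b).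
Proof.
rewrite /GRing.comm => bX ab; apply: subr0_eq.
transitivity ((b * X - c *: (X * b)) * a - x *: (a * (b * X - c *: (X * b)))
  + c *: (X * (b * a - a * b)) - x *: ((b * a - a * b) * X)).
  rewrite /qbr; ncr.
by rewrite ab bX !(mul0r, mulr0, scaler0, subrr, addr0).
Qed.

Lemma qbr_comm x X a b :
  GRing.comm X b -> GRing.comm a b -> GRing.comm (qbr x X a) b.
Proof.
move=> Xb ab; have := @qbr_qcomm 1 x X a b; rewrite !scale1r => H.
by rewrite /GRing.comm H // -Xb.
Qed.

(** Each Serre relation for the middle letter [a] is multiplied on the left and on the right by the
    missing outer letter; the combination is x + y times the commutator. In the applications x and y
    are r^2 and s^2, or their inverses, so r^2 + s^2 must be invertible. *)
Lemma middle_comm x y X a b :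
  x + y != 0 -> GRing.comm X b ->
  qbr y (qbr x X a) a = 0 -> qbr y a (qbr x a b) = 0 ->
  GRing.comm (qbr x (qbr x X a) b) a.
Proof.
rewrite /GRing.comm => xy0 Xb S1 S2; apply: subr0_eq; apply: (scale_eq0 _ _ xy0).
transitivity (qbr y (qbr x X a) a * b - (x * x) *: (b * qbr y (qbr x X a) a)
  - X * qbr y a (qbr x a b) + (x * x) *: (qbr y a (qbr x a b) * X)
  + (x * y) *: ((X * b - b * X) * a * a)
  - (x * (x + y)) *: (a * (X * b - b * X) * a)
  + (x * x) *: (a * a * (X * b - b * X))).
  rewrite /qbr; ncr.
by rewrite S1 S2 Xb !subrr !(mul0r, mulr0, scaler0, subrr, addr0).
Qed.

(* Brackets the relations of X and of U with b successively with a, as in the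
   classical proof that ad(a) of a vanishing bracket vanishes. *)
Lemma short_comm r s X a b :
  r * s * (r * r + r * s + s * s) != 0 ->
  let U := qbr (r * r) X a in
  let Y := qbr (r * s) U a in
  let W := qbr (r * r) b a in
  X * b = (s * s) *: (b * X) -> GRing.comm U b ->
  qbr (s * s) Y a = 0 -> qbr (s * s) (qbr (r * s) W a) a = 0 ->
  GRing.comm Y W.
Proof.
move=> rs0 U Y W; rewrite /GRing.comm => /eqP; rewrite -subr_eq0 => /eqP h1.
move=> /eqP; rewrite -subr_eq0 => /eqP h2 h3 h4.
set W2 := qbr (r * s) W a in h4.
pose simp := (mul0r, mulr0, scaler0, subrr, addr0, oppr0).
(* The coefficient of [W * U] when [e1] is bracketed with [a]: the term in [b * U] contributes r s
   (s^2 - r^2), the term in [W * X] contributes r^2 s^2. *)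
pose k := r * s * (s * s - r * r + r * s).
have e1 : X * W - (s * s - r * r) *: (b * U) - (r * r * s * s) *: (W * X) = 0.
  transitivity ((X * b - (s * s) *: (b * X)) * a - (r * r) *: (U * b - b * U)
    - (r * r * r * r) *: (a * (X * b - (s * s) *: (b * X)))).
    rewrite /U /W /qbr; ncr.
  by rewrite h1 h2 !simp.
have e2 : U * W + (r * r) *: (Y * b) - b * Y - (r * s) *: (W * U) = 0.
  transitivity ((U * b - b * U) * a - (r * r * r * s) *: (a * (U * b - b * U))).
    rewrite /Y /U /W /qbr; ncr.
  by rewrite h2 !simp.
have e3 : X * W2 + (r * s) *: (U * W) - (s * s - r * r) *: (b * Y) - k *: (W * U)
          - (r * r * r * r * s * s) *: (W2 * X) = 0.
  transitivity ((X * W - (s * s - r * r) *: (b * U) - (r * r * s * s) *: (W * X)) * a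
    - (r * r * r * s) *:
      (a * (X * W - (s * s - r * r) *: (b * U) - (r * r * s * s) *: (W * X)))).
    rewrite /W2 /Y /U /W /k /qbr; ncr.
  by rewrite e1 !simp.
have e4 : U * W2 + (r * (r + s)) *: (Y * W) - (s * (r + s)) *: (W * Y)
          - (r * r * s * s) *: (W2 * U) = 0.
  transitivity ((U * W + (r * r) *: (Y * b) - b * Y - (r * s) *: (W * U)) * a
    - (r * r * s * s) *: (a * (U * W + (r * r) *: (Y * b) - b * Y - (r * s) *: (W * U)))
    - (r * r * r * r) *: (qbr (s * s) Y a * b) + b * qbr (s * s) Y a).
    rewrite /W2 /Y /U /W /qbr; ncr.
  by rewrite e2 h3 !simp.
have e5 : (s * (s + r)) *: (U * W2) + (r * r * s * s) *: (Y * W)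
          - ((s * s - r * r) * s * (s + r) + r * r * s * s) *: (W * Y)
          - (r * r * s * s * s * (r + s)) *: (W2 * U) = 0.
  transitivity ((X * W2 + (r * s) *: (U * W) - (s * s - r * r) *: (b * Y)
      - k *: (W * U) - (r * r * r * r * s * s) *: (W2 * X)) * a
    - (r * r * s * s) *: (a * (X * W2 + (r * s) *: (U * W)
      - (s * s - r * r) *: (b * Y) - k *: (W * U) - (r * r * r * r * s * s) *: (W2 * X)))
    - X * qbr (s * s) W2 a + (s * s - r * r) *: (b * qbr (s * s) Y a)
    + (r * r * r * r * r * r * s * s) *: (qbr (s * s) W2 a * X)).
    rewrite /W2 /Y /U /W /k /qbr; ncr.
  by rewrite e3 h3 h4 !simp.
(* Eliminating [U * W2] and [W2 * U] between [e4] and [e5] leaves r s (r^2 + r s + s^2) times the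
   commutator of [Y] and [W]. *)
apply: subr0_eq; apply: (scale_eq0 _ _ rs0).
transitivity ((s * (r + s)) *: (U * W2 + (r * (r + s)) *: (Y * W)
     - (s * (r + s)) *: (W * Y) - (r * r * s * s) *: (W2 * U))
  - ((s * (s + r)) *: (U * W2) + (r * r * s * s) *: (Y * W)
     - ((s * s - r * r) * s * (s + r) + r * r * s * s) *: (W * Y)
     - (r * r * s * s * s * (r + s)) *: (W2 * U))).
  clear; move: U Y W W2 => U Y W W2; ncr.
by rewrite e4 e5 !simp.
Qed.

(** The relation between [X] and [U] is bracketed twice with [a]. The cubic relation between [Y] and
    [a] removes the remaining terms and leaves r s times the claim. *)
Lemma short_serre r s X a :
  r * s != 0 ->
  let U := qbr (r * r) X a in
  let Y := qbr (r * s) U a in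
  X * U = (s * s) *: (U * X) -> qbr (s * s) Y a = 0 ->
  U * Y = (s * s) *: (Y * U).
Proof.
move=> rs0 U Y /eqP; rewrite -subr_eq0 => /eqP j1 h3.
pose simp := (mul0r, mulr0, scaler0, subrr, addr0, oppr0).
have g1 : X * Y - (r * r * s * s) *: (Y * X) - (s * (s - r)) *: (U * U) = 0.
  transitivity ((X * U - (s * s) *: (U * X)) * a
     - (r * r * r * s) *: (a * (X * U - (s * s) *: (U * X)))).
    rewrite /Y /U /qbr; ncr.
  by rewrite j1 !simp.
apply: subr0_eq; apply: (scale_eq0 _ _ rs0).
transitivity ((X * Y - (r * r * s * s) *: (Y * X) - (s * (s - r)) *: (U * U)) * a
  - (r * r * s * s) *: (a * (X * Y - (r * r * s * s) *: (Y * X) - (s * (s - r)) *: (U * U)))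
  - X * qbr (s * s) Y a + (r * r * r * r * s * s) *: (qbr (s * s) Y a * X)).
  rewrite /Y /U /qbr; ncr.
by rewrite g1 h3 !simp.
Qed.

(** [E] passes [X] with the factor d, because [U] does and [b] commutes with [X]; it passes [a] with
    the factor c. Hence it passes the bracket [U] of the two with the factor c d. *)
Lemma adjacent_step q q' c d X a b :
  let U := qbr q X a in
  let E := qbr q' U b in
  GRing.comm X b -> E * a = c *: (a * E) -> U * X = d *: (X * U) ->
  E * U = (c * d) *: (U * E).
Proof.
move=> U E; rewrite /GRing.comm => Xb /eqP; rewrite -subr_eq0 => /eqP h.
move=> /eqP; rewrite -subr_eq0 => /eqP j.
pose simp := (mul0r, mulr0, scaler0, subrr, addr0, oppr0).
have g : E * X - d *: (X * E) = 0.
  transitivity ((U * X - d *: (X * U)) * b - q' *: (b * (U * X - d *: (X * U)))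
    - U * (X * b - b * X) + (d * q') *: ((X * b - b * X) * U)).
    rewrite /E; clear; move: U => U; rewrite /qbr; ncr.
  by rewrite j Xb !simp.
apply: subr0_eq.
transitivity ((E * X - d *: (X * E)) * a + d *: (X * (E * a - c *: (a * E)))
  - q *: ((E * a - c *: (a * E)) * X + c *: (a * (E * X - d *: (X * E))))).
  rewrite /U; clear; move: E => E; rewrite /qbr; ncr.
by rewrite g h !simp.
Qed.

Lemma qbr_flip c X a : c != 0 -> qbr c X a = (- c) *: qbr c^-1 a X.
Proof. by move=> c0; rewrite /qbr scalerBr scalerA mulNr mulfV // !scaleNr scale1r opprK addrC. Qed.

Lemma qbrZl c k X a : qbr c (k *: X) a = k *: qbr c X a.
Proof. by rewrite /qbr scalerBr -scalerAl -scalerAr !scalerA mulrC. Qed.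

(** Left and right multiplication by [a] commute, so the parameters of a quadratic Serre relation
    may be taken in either order. *)
Lemma qbr_swapr x y a b : qbr x a (qbr y a b) = qbr y a (qbr x a b).
Proof. rewrite /qbr; ncr. Qed.

End Brackets.
Arguments qbr {K A}.

(** * Chains of root vectors *)

Definition qcomm (K : fieldType) (A : algType K) (X b : A) : Prop :=
  exists2 c : K, c != 0 & X * b = c *: (b * X).
Arguments qcomm {K A}.

Section QComm.
Variables (K : fieldType) (A : algType K).
Implicit Types (X a b : A) (x c : K).

Lemma qcomm_sym X b : qcomm X b -> qcomm b X.
Proof.
case=> c c0 E; exists c^-1; first by rewrite invr_eq0.
by rewrite E scalerA mulVf // scale1r.
Qed.

Lemma comm_qcomm X b : GRing.comm X b -> qcomm X b.
Proof. by move=> E; exists 1; rewrite ?oner_neq0 // scale1r. Qed.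

Lemma qbr0_qcomm c X b : c != 0 -> qbr c X b = 0 -> qcomm X b.
Proof. by move=> c0 /subr0_eq E; exists c. Qed.

Lemma qcomm_qbr x X a b : qcomm X b -> GRing.comm a b -> qcomm (qbr x X a) b.
Proof.
move=> /qcomm_sym[c c0 E] ab; apply: qcomm_sym; exists c => //.
exact: qbr_qcomm.
Qed.

End QComm.

(** * Right ideals and their annihilation by products of powers *)

Section RightIdeal.
Variables (K : fieldType) (A : algType K).
Implicit Types (S T : A -> Prop) (x z a b P : A).

Inductive rideal S : A -> Prop :=
| rideal0 : rideal S 0
| ridealMD x a z : S x -> rideal S z -> rideal S (x * a + z).

Lemma rideal_gen S x a : S x -> rideal S (x * a).
Proof. by move=> Sx; rewrite -[_ * _]addr0; apply: ridealMD => //; apply: rideal0. Qed.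

Lemma rideal_mem S x : S x -> rideal S x.
Proof. by move=> Sx; rewrite -[x]mulr1; apply: rideal_gen. Qed.

Lemma ridealD S y z : rideal S y -> rideal S z -> rideal S (y + z).
Proof.
by move=> Sy Sz; elim: Sy => [|x a y' Sx _ IH]; rewrite ?add0r // -addrA; apply: ridealMD.
Qed.

Lemma ridealMr S z b : rideal S z -> rideal S (z * b).
Proof.
elim=> [|x a y Sx _ IH]; first by rewrite mul0r; apply: rideal0.
by rewrite mulrDl -mulrA; apply: ridealMD.
Qed.

Lemma ridealZ S (c : K) z : rideal S z -> rideal S (c *: z).
Proof. by rewrite -mulr_algr; apply: ridealMr. Qed.

Lemma ridealB S y z : rideal S y -> rideal S z -> rideal S (y - z).
Proof. by move=> Sy Sz; rewrite -scaleN1r; apply/ridealD/ridealZ. Qed.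

Lemma ridealMl S T b z : (forall x, S x -> rideal T (b * x)) ->
  rideal S z -> rideal T (b * z).
Proof.
move=> bS; elim=> [|x a y Sx _ IH]; first by rewrite mulr0; apply: rideal0.
by rewrite mulrDr mulrA; apply: ridealD => //; apply/ridealMr/bS.
Qed.

Lemma rideal_sub S T z : (forall x, S x -> T x) -> rideal S z -> rideal T z.
Proof.
move=> ST Sz; rewrite -[z]mul1r; apply: ridealMl Sz => x /ST Tx.
by rewrite mul1r; apply: rideal_mem.
Qed.

Lemma rideal_kill S P z : (forall x, S x -> P * x = 0) -> rideal S z -> P * z = 0.
Proof.
move=> PS; elim=> [|x a y Sx _ IH]; first exact: mulr0.
by rewrite mulrDr mulrA PS // mul0r add0r.
Qed.

(** One step of the annihilation argument: [x] is the next root vector, [S] the set of its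
    predecessors and [P] the product of their powers. *)
Lemma kill_step S P x l : (0 < l)%N -> x ^+ l = 0 ->
  (forall z, S z -> P * z = 0) -> (forall z, S z -> rideal S (x * z)) ->
  forall z, S z \/ z = x -> P * x ^+ l.-1 * z = 0.
Proof.
move=> l0 xl PS xS z [Sz | ->]; last by rewrite -mulrA -exprSr prednK // xl mulr0.
have: rideal S (x ^+ l.-1 * z).
  elim: l.-1 => [|k IH]; first by rewrite mul1r; apply: rideal_mem.
  by rewrite exprS -mulrA; apply: ridealMl IH.
by rewrite -mulrA; apply: rideal_kill.
Qed.

End RightIdeal.
Arguments rideal {K A}.

Section Chain.
Variables (K : fieldType) (A : algType K) (n : nat) (r s : K) (e : nat -> A).

Hypothesis e_far : forall i j, (0 < i)%N -> (i.+1 < j)%N -> (j <= n)%N ->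
  GRing.comm (e i) (e j).

(** The chain of [i] follows the positive roots ε_i - ε_{i+1}, ..., ε_i - ε_n, ε_i, ε_i + ε_n, ...,
    ε_i + ε_{i+1}. The short simple root is therefore added twice in a row, at positions n - 1 and
    n. *)
Definition step_idx p := if (p < n)%N then p.+1 else (n.*2 - p)%N.
Definition step_coef p : K :=
  if (p < n)%N then r * r else if p == n then r * s else (s * s)^-1.

Fixpoint chain i k : A :=
  if k is k'.+1 then qbr (step_coef (i + k')) (chain i k') (e (step_idx (i + k')))
  else e i.

(* The root vectors with first index [i]: position [p <= n] is E_{i,p} and
   position [p > n] is E_{i,(2n+1-p)'}. *)
Definition rootv i p := chain i (p - i).

Lemma rootv_diag i : rootv i i = e i.
Proof. by rewrite /rootv subnn. Qed.

Lemma rootvS i p : (i <= p)%N ->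
  rootv i p.+1 = qbr (step_coef p) (rootv i p) (e (step_idx p)).
Proof. by move=> ip; rewrite /rootv subSn //= subnKC. Qed.

Lemma rootv_asc i p : (i <= p)%N -> (p < n)%N ->
  rootv i p.+1 = qbr (r * r) (rootv i p) (e p.+1).
Proof. by move=> ip pn; rewrite rootvS // /step_coef /step_idx pn. Qed.

Lemma rootv_top i : (i <= n)%N -> rootv i n.+1 = qbr (r * s) (rootv i n) (e n).
Proof.
move=> ip; rewrite rootvS // /step_coef /step_idx ltnn eqxx.
by rewrite -addnn addnK.
Qed.

Lemma rootv_desc i p : (i <= n)%N -> (n < p)%N ->
  rootv i p.+1 = qbr (s * s)^-1 (rootv i p) (e (n.*2 - p)).
Proof.
move=> i_n np; rewrite rootvS; last exact: leq_trans i_n (ltnW np).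
by rewrite /step_coef /step_idx ltnNge ltnW // gtn_eqF.
Qed.

(** Reconciles the recursion that defines E_{i,j}, which adds e_i on the left, with the chain, which
    grows on the right; [qbrA] exchanges the two since e_i commutes with distant generators. *)
Lemma rootv_left i j : (0 < i)%N -> (i < j <= n)%N ->
  rootv i j = qbr (r * r) (e i) (rootv i.+1 j).
Proof.
move=> i0; elim: j => [|j IH] ij; first by lia.
rewrite rootv_asc; [|lia|lia].
have [ji|ji] := eqVneq i j; first by rewrite -ji !rootv_diag.
rewrite IH; last by lia.
rewrite rootv_asc; [|lia|lia].
by rewrite qbrA //; apply: e_far; lia.
Qed.

Hypotheses (r0 : r != 0) (s0 : s != 0) (rs2 : r * r + s * s != 0).
Hypothesis rs3 : r * r + r * s + s * s != 0.
Hypothesis serre_right : forall i, (0 < i)%N -> (i < n)%N ->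
  qbr (s * s) (e i) (qbr (r * r) (e i) (e i.+1)) = 0.
Hypothesis serre_left : forall i, (0 < i)%N -> (i.+1 < n)%N ->
  qbr (s * s) (qbr (r * r) (e i) (e i.+1)) (e i.+1) = 0.
Hypothesis serre_short : forall i, (0 < i)%N -> i.+1 = n ->
  qbr (s * s) (qbr (r * s) (qbr (r * r) (e i) (e n)) (e n)) (e n) = 0.

Lemma rr0 : r * r != 0. Proof. by rewrite mulf_neq0. Qed.
Lemma ss0 : s * s != 0. Proof. by rewrite mulf_neq0. Qed.
Lemma rs0 : r * s != 0. Proof. by rewrite mulf_neq0. Qed.

Lemma e_far' i j : (0 < j)%N -> (j.+1 < i)%N -> (i <= n)%N -> GRing.comm (e i) (e j).
Proof. by move=> *; apply: commr_sym; apply: e_far. Qed.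

(** Reversing the brackets of [serre_right] inverts their parameters; this is the form met on the
    descending half of a chain. *)
Lemma serre_desc m : (0 < m)%N -> (m < n)%N ->
  qbr (r * r)^-1 (qbr (s * s)^-1 (e m.+1) (e m)) (e m) = 0.
Proof.
move=> m0 mn; rewrite (qbr_flip _ _ (s * s)^-1) ?invr_eq0 ?ss0 // qbrZl.
rewrite (qbr_flip _ _ (r * r)^-1) ?invr_eq0 ?rr0 // !invrK qbr_swapr.
by rewrite serre_right // !scaler0.
Qed.

Lemma serre_desc' m : (0 < m)%N -> (m.+1 < n)%N ->
  qbr (r * r)^-1 (e m.+1) (qbr (s * s)^-1 (e m.+1) (e m)) = 0.
Proof.
move=> m0 mn; have := serre_left _ m0 mn.
rewrite (qbr_flip _ _ (r * r)) ?rr0 // qbrZl (qbr_flip _ _ (s * s)) ?ss0 // scalerA.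
by rewrite qbr_swapr; apply: scale_eq0; rewrite mulf_neq0 // oppr_eq0 ?rr0 ?ss0.
Qed.

(** * Commutation relations within a single chain *)

Section Block.
Variable i : nat.
Hypothesis i0 : (0 < i)%N.
Local Notation V := (rootv i).

Lemma asc_far p j : (i <= p <= n)%N -> (p.+1 < j <= n)%N -> GRing.comm (V p) (e j).
Proof.
elim: p => [|p IH] Hp Hj; first by lia.
have [ip|ip] := eqVneq i p.+1; first by rewrite -ip rootv_diag; apply: e_far; lia.
rewrite rootv_asc; [|lia|lia]; apply: qbr_comm; last by apply: e_far; lia.
by apply: IH; lia.
Qed.

Lemma asc_bracket p c : (i < p < n)%N ->
  qbr c (V p) (e p.+1) = qbr (r * r) (V p.-1) (qbr c (e p) (e p.+1)).
Proof.
case: p => [|p] //= Hp; rewrite rootv_asc; [|lia|lia].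
by rewrite qbrA //; apply: asc_far; lia.
Qed.

Lemma asc_comm2 p : (i < p < n)%N -> GRing.comm (V p.-1) (e p.+1).
Proof. by move=> Hp; apply: asc_far; lia. Qed.

(** The vector at position p - 1 commutes with e_{p+1}, so both brackets with e_{p+1} move inside
    and meet the Serre relation of e_p and e_{p+1}. *)
Lemma asc_serre p : (i <= p)%N -> (p.+1 < n)%N -> qbr (s * s) (V p.+1) (e p.+1) = 0.
Proof.
move=> ip pn; rewrite rootv_asc; [|lia|lia].
have [ip'|ip'] := eqVneq i p; first by rewrite -ip' rootv_diag serre_left // ip'.
have Hp : (i < p < n)%N by lia.
rewrite asc_bracket // qbrA; last exact: asc_comm2.
by rewrite serre_left ?qbrx0 //; lia.
Qed.

Lemma asc_cubic p : (i <= p)%N -> p.+1 = n ->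
  qbr (s * s) (qbr (r * s) (V n) (e n)) (e n) = 0.
Proof.
move=> ip pn; have := rootv_asc i p ip ltac:(lia); rewrite pn => ->.
have [ip'|ip'] := eqVneq i p; first by rewrite -ip' rootv_diag serre_short // ip'.
have Hp : (i < p < n)%N by lia.
have Hc := asc_comm2 _ Hp; have := asc_bracket p (r * r) Hp.
rewrite pn in Hc *; move=> ->.
by rewrite !(qbrA _ _ _ _ _ _ _ Hc) serre_short ?qbrx0 //; lia.
Qed.

(** At p = j + 1 the generator e_j is the middle letter of [middle_comm]; every later step brackets
    with a generator that commutes with e_j. *)
Lemma asc_middle p j : (p <= n)%N -> (i < j < p)%N -> GRing.comm (V p) (e j).
Proof.
elim: p j => [|p IH] j pn /andP[ij jp]; first by lia.
rewrite rootv_asc; [|lia|lia].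
have [jp'|jp'] := eqVneq j p; last first.
  by apply: qbr_comm; [apply: IH | apply: e_far']; lia.
rewrite -jp'; case: j ij jp jp' => // j ij jp jp'.
rewrite rootv_asc; [|lia|lia].
apply: (middle_comm _ _ _ (s * s)) => //.
- by apply: asc_far; lia.
- by rewrite -rootv_asc ?asc_serre //; lia.
- by apply: serre_right; lia.
Qed.

Lemma asc_adj p : (i <= p < n)%N ->
  V p.+1 * V p = (s * s)^-1 *: (V p * V p.+1).
Proof.
elim: p => [|p IH] Hp; first by lia.
have [ip|ip] := eqVneq i p.+1.
  rewrite -ip rootv_asc //; last by lia.
  rewrite rootv_diag; have /subr0_eq -> := serre_right i i0 ltac:(lia).
  by rewrite scalerA mulVf ?ss0 // scale1r.
rewrite (rootv_asc i p.+1); [|lia|lia]; rewrite {2 3}rootv_asc; [|lia|lia].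
(* The factor 1 is the constant c of [adjacent_step], as the new vector commutes with e_{p+1}. *)
have -> : (s * s)^-1 = 1 * (s * s)^-1 by rewrite mul1r.
rewrite (rootv_asc i p); [|lia|lia].
apply: (adjacent_step _ _ _ _ 1).
- by apply: asc_far; lia.
- rewrite -!rootv_asc; [|lia..]; rewrite scale1r.
  by apply: asc_middle; lia.
- by rewrite -rootv_asc; [apply: IH; lia|lia|lia].
Qed.

Hypothesis i_n : (i < n)%N.

Lemma rootv_n : V n = qbr (r * r) (V n.-1) (e n).
Proof. by rewrite -{1}(ltn_predK i_n) rootv_asc ?(ltn_predK i_n) //; lia. Qed.

Lemma top_cubic : qbr (s * s) (V n.+1) (e n) = 0.
Proof. by rewrite rootv_top 1?ltnW // (asc_cubic n.-1) //; lia. Qed.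

Lemma top_adj : V n.+1 * V n = (s * s)^-1 *: (V n * V n.+1).
Proof.
have H : V n.-1 * V n = (s * s) *: (V n * V n.-1).
  have := asc_adj n.-1; rewrite (ltn_predK i_n) => -> //; last by lia.
  by rewrite scalerA mulfV ?ss0 // scale1r.
move: top_cubic; rewrite rootv_top 1?ltnW // rootv_n => cub.
rewrite rootv_n in H.
have -> := short_serre _ _ _ _ _ _ rs0 H cub.
by rewrite scalerA mulVf ?ss0 // scale1r.
Qed.

Lemma desc_far p j : (n <= p)%N -> (i < j)%N -> (j < n.*2 - p)%N ->
  GRing.comm (V p) (e j).
Proof.
elim: p => [|p IH] np ij jp; first by lia.
have [pn|pn] := eqVneq n p.+1; first by apply: asc_middle; lia.
have [pn'|pn'] := eqVneq n p.
  rewrite -pn' rootv_top 1?ltnW //; apply: qbr_comm; last by apply: e_far'; lia.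
  by apply: asc_middle; lia.
rewrite rootv_desc; [|lia|lia].
by apply: qbr_comm; [apply: IH|apply: e_far']; lia.
Qed.

(** Here e_n has been bracketed in twice, so [middle_comm] does not apply. Instead [short_comm]
    shows that E_{i,n'} commutes with the bracket of e_{n-1} and e_n, and E_{i,n'} q-commutes with
    e_n. *)
Lemma top_short : (i.+1 < n)%N -> V n.+2 * e n = (r * r * s * s) *: (e n * V n.+2).
Proof.
move=> i_n'; rewrite rootv_desc; [|lia|lia].
have -> : (n.*2 - n.+1)%N = n.-1 by lia.
set b := e n.-1; set Y := V n.+1.
have h1 : V n.-1 * b = (s * s) *: (b * V n.-1).
  apply: subr0_eq; have := asc_serre n.-2.
  by have -> : n.-2.+1 = n.-1 by [lia]; apply; lia.
have h2 : GRing.comm (V n) b by apply: asc_middle; lia.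
have h3 := top_cubic.
have h4 : qbr (s * s) (qbr (r * s) (qbr (r * r) b (e n)) (e n)) (e n) = 0.
  by apply: serre_short; lia.
have YW : GRing.comm Y (qbr (r * r) b (e n)).
  rewrite /Y rootv_top 1?ltnW // in h3 *; rewrite rootv_n in h2 h3 *.
  by apply: short_comm h1 h2 h3 h4; rewrite mulf_neq0 ?rs0 ?rs3.
apply: subr0_eq.
(* The inverse of s^2 becomes a variable [v], which makes the coefficients polynomial; the multiples
   of v s^2 - 1 below restore the relation that defines it. *)
have ss1 : (s * s)^-1 * (s * s) = 1 by rewrite mulVf ?ss0.
move: (s * s)^-1 ss1 => v ss1.
transitivity (Y * qbr (r * r) b (e n) - qbr (r * r) b (e n) * Y
  + (v * (s * s) - 1) *: ((r * r) *: (e n * b * Y))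
  - v *: (b * qbr (s * s) Y (e n)) - (v * (s * s) - 1) *: (b * e n * Y)
  + (r * r) *: (qbr (s * s) Y (e n) * b)).
  clear; move: Y => Y; rewrite /qbr.
  nc_ring (K : comNzRingType) A.
by rewrite YW h3 ss1 !(mul0r, mulr0, scaler0, scale0r, subrr, addr0).
Qed.

Lemma rootv_down p : (n <= p)%N ->
  V p.+1 = qbr (step_coef p) (V p) (e (n.*2 - p)).
Proof. by move=> np; rewrite rootvS 1?(leq_trans (ltnW i_n)) // /step_idx ltnNge np. Qed.

(** The vector two positions earlier commutes with the repeated generator, so all brackets move
    inside and [serre_desc] applies. The earlier step may be the one at position n, whose
    coefficient r s is irrelevant to this argument. *)
Lemma desc_serre p : (n < p)%N -> (p < n.*2 - i)%N ->
  qbr (r * r)^-1 (V p.+1) (e (n.*2 - p)) = 0.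
Proof.
case: p => // p np pi; rewrite rootv_desc; [|lia|lia].
set m := (n.*2 - p.+1)%N; have m1 : (n.*2 - p)%N = m.+1 by lia.
have Vm : GRing.comm (V p) (e m) by apply: desc_far; lia.
by rewrite rootv_down // m1 !(qbrA _ _ _ _ _ _ _ Vm) serre_desc ?qbrx0 //; lia.
Qed.

Lemma desc_middle p : (n < p)%N -> (p.+1 < n.*2 - i)%N ->
  GRing.comm (V p.+2) (e (n.*2 - p)).
Proof.
move=> np pi; rewrite !rootv_desc; [|lia..].
set m := (n.*2 - p.+1)%N; have m1 : (n.*2 - p)%N = m.+1 by lia.
rewrite m1; apply: (middle_comm _ _ _ (r * r)^-1).
- have -> : (s * s)^-1 + (r * r)^-1 = (r * r * (s * s))^-1 * (r * r + s * s).
    by field; rewrite r0 s0.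
  by rewrite mulf_neq0 // invr_eq0 mulf_neq0 // ?rr0 ?ss0.
- by apply: desc_far; lia.
- by rewrite -m1 -rootv_desc ?desc_serre //; lia.
- by apply: serre_desc'; lia.
Qed.

(** The relation first arises one step after e_j enters on the descending half: [top_short] if j =
    n, [desc_middle] otherwise. The later generators commute with e_j. *)
Lemma desc_high p j : (n.+1 < p)%N -> (p <= n.*2 - i)%N ->
  (n.*2 - p < j.-1)%N -> (j <= n)%N -> qcomm (V p) (e j).
Proof.
elim: p => [|p IH] np pi pj jn; first by lia.
have [jE|jE] := eqVneq j (n.*2 - p.-1)%N; last first.
  rewrite rootv_desc; [|lia|lia].
  apply: qcomm_qbr; last by apply: e_far; lia.
  by apply: IH; lia.
have [pn|pn] := eqVneq p n.+1.
  exists (r * r * s * s); first by rewrite !mulf_neq0.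
  have -> : j = n by lia.
  by rewrite pn top_short //; lia.
case: p jE pn np pi {IH pj} => // p -> pn np pi.
by apply/comm_qcomm/desc_middle; lia.
Qed.

(** Three kinds of index occur: those not yet reached, those passed earlier, and that of the last
    step, where a Serre relation applies. *)
Lemma rootv_qcomm p j : (i <= p)%N -> (p <= n.*2 - i)%N -> (i < j <= n)%N ->
  j != step_idx p -> qcomm (V p) (e j).
Proof.
move=> ip pn /andP[ij jn]; rewrite /step_idx; case: ltnP => np jp.
  have [pj|pj] := ltnP p j; first by apply/comm_qcomm/asc_far; lia.
  have [pj'|pj'] := ltnP j p; first by apply/comm_qcomm/asc_middle; lia.
  have -> : p = j by lia.
  case: j ij jn jp pj pj' => // j *.
  by apply: (qbr0_qcomm _ _ _ _ _ ss0); apply: asc_serre; lia.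
have [jlt|jge] := ltnP j (n.*2 - p); first by apply/comm_qcomm/desc_far; lia.
have [jE|jE] := eqVneq j.-1 (n.*2 - p)%N; last by apply: desc_high; lia.
have [pn'|pn'] := eqVneq p n.+1.
  have -> : j = n by lia.
  by rewrite pn'; apply: (qbr0_qcomm _ _ _ _ _ ss0); exact: top_cubic.
case: p ip pn np jp jge jE pn' => [|p] *; first by lia.
have -> : j = (n.*2 - p)%N by lia.
apply: (@qbr0_qcomm _ _ (r * r)^-1); first by rewrite invr_eq0 rr0.
by apply: desc_serre; lia.
Qed.

Lemma rootv_adj p : (i <= p)%N -> (p < n.*2 - i)%N -> 
  exists d, V p.+1 * V p = d *: (V p * V p.+1).
Proof.
elim: p => [|p IH] ip pi; first by lia.
have [pn|pn] := ltnP p.+1 n; first by exists (s * s)^-1; apply: asc_adj; lia.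
have [pn'|pn'] := eqVneq p.+1 n; first by exists (s * s)^-1; rewrite pn' top_adj.
have np : (n <= p)%N by lia.
have [||d] := IH; [lia|lia|].
(* The generator that led from position p to p + 1 q-commutes with the vector at p + 2, which is the
   input c of [adjacent_step]. *)
have [||||c _] := desc_high p.+2 (n.*2 - p); [lia..|].
rewrite (rootv_desc i p.+1); [|lia|lia].
rewrite (rootv_down p) // => E1 E2; exists (c * d).
by apply: adjacent_step E1 E2; apply: desc_far; lia.
Qed.

End Block.

(** * Stability of the right ideals, and the vanishing of x e_j *)

Definition in_block i k (x : A) : Prop :=
  exists2 m, [&& (i <= m)%N, (m < k)%N & (m <= n.*2 - i)%N] & x = rootv i m.

(** The generators of J_k are the members of all preceding chains, given here, together with the
    initial segment [in_block] of the current one. *)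
Definition earlier i (x : A) : Prop :=
  exists i', exists2 m, [&& (0 < i')%N, (i' < i)%N, (i' <= m)%N & (m <= n.*2 - i')%N]
                        & x = rootv i' m.

Lemma step_coef_neq0 p : step_coef p != 0.
Proof.
by rewrite /step_coef; case: ifP => _; [exact: rr0 | case: ifP => _; rewrite ?invr_eq0 ?ss0 ?rs0].
Qed.

Lemma in_block_e i j k z : (0 < i)%N -> (i < j <= n)%N ->
  rideal (in_block i k) z -> rideal (in_block i k.+1) (e j * z).
Proof.
move=> i0 ijn; apply: ridealMl => _ [m /and3P[im mk mi] ->].
have Vm : in_block i k.+1 (rootv i m) by exists m => //; rewrite im mi; lia.
have [jE|jE] := eqVneq j (step_idx m); last first.
  have i_n : (i < n)%N by lia.
  have [c _ ->] := qcomm_sym _ _ _ _ (rootv_qcomm i i0 i_n m j im mi ijn jE).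
  by apply/ridealZ/rideal_gen.
(* At the last position the next step would be e_i, which i < j excludes. *)
have m1 : (m.+1 <= n.*2 - i)%N.
  by move: jE; rewrite /step_idx; case: ltnP; lia.
have -> : e j * rootv i m = (step_coef m)^-1 *: (rootv i m * e j - rootv i m.+1).
  rewrite rootvS // /qbr -jE opprB addrC subrK.
  by rewrite scalerA mulVf ?step_coef_neq0 // scale1r.
apply/ridealZ/ridealB; first exact: rideal_gen.
by apply: rideal_mem; exists m.+1 => //; apply/and3P; split=> //; lia.
Qed.

Lemma step_idx_range i p : (i <= p)%N -> (p < n.*2 - i)%N -> (i < step_idx p <= n)%N.
Proof. by move=> ip pi; rewrite /step_idx; case: (ltnP p n) => np; lia. Qed.

(** Expand the last bracket of the left factor. One term begins with its predecessor; the other is a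
    generator times a product covered by induction. Only m = k - 1 escapes the induction, and there
    neighbours q-commute. *)
Lemma in_block_rootv i m k : (0 < i)%N -> (i <= m)%N -> (m < k)%N -> (k <= n.*2 - i)%N ->
  rideal (in_block i k) (rootv i k * rootv i m).
Proof.
move=> i0; elim: k m => // k IH m im mk ki.
have Vm : in_block i k.+1 (rootv i m) by exists m => //; apply/and3P; split=> //; lia.
have [mE|mE] := eqVneq m k.
  have i_n : (i < n)%N by lia.
  have [d E] := rootv_adj i i0 i_n m im ltac:(lia).
  by move: Vm; rewrite -mE E => Vm; apply/ridealZ/rideal_gen.
have ik : (i <= k)%N by lia.
rewrite rootvS // /qbr mulrBl -mulrA; apply: ridealB.
  by apply: rideal_gen; exists k => //; apply/and3P; split=> //; lia.
rewrite -scalerAl -mulrA; apply/ridealZ/in_block_e => //.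
  exact: step_idx_range.
by apply: IH; lia.
Qed.

Lemma earlier_e i j z : (0 < j <= n)%N ->
  rideal (earlier i) z -> rideal (earlier i) (e j * z).
Proof.
move=> /andP[j0 jn]; apply: ridealMl => _ [i' [m /and4P[i'0 i'i i'm mi'] ->]].
(* For j <= i' the generator e_j itself starts an earlier chain; for larger j the product stays in
   the ideal of chain i'. *)
have [ji|ij] := leqP j i'.
  apply: rideal_gen; exists j, j; last by rewrite rootv_diag.
  by apply/and4P; split=> //; lia.
apply: (@rideal_sub _ _ (in_block i' m.+2)).
  move=> x [p /and3P[H1 H2 H3] ->]; exists i', p => //.
  by apply/and4P; split=> //; lia.
apply: in_block_e => //; first by rewrite ij.
by apply: rideal_mem; exists m => //; apply/and3P; split=> //; lia.
Qed.

Lemma earlier_rootv i i' p z : (0 < i' <= n)%N -> (i' <= p)%N -> (p <= n.*2 - i')%N ->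
  rideal (earlier i) z -> rideal (earlier i) (rootv i' p * z).
Proof.
move=> i'n; elim: p z => [|p IH] z i'p pi' Jz; first by lia.
have [pE|pE] := eqVneq i' p.+1; first by rewrite -pE rootv_diag; apply: earlier_e.
have i'p' : (i' <= p)%N by lia.
have Hs := step_idx_range _ _ i'p' ltac:(lia).
rewrite rootvS // /qbr mulrBl -mulrA -scalerAl -mulrA; apply: ridealB.
  by apply: IH; [lia..|apply: earlier_e => //; lia].
by apply/ridealZ/earlier_e; [lia|apply: IH => //; lia].
Qed.

Variable l : nat.
Hypothesis l0 : (0 < l)%N.
Hypothesis rootv_nil : forall i m, (0 < i)%N -> (i <= m)%N -> (m <= n.*2 - i)%N ->
  rootv i m ^+ l = 0.

(** Iterates [kill_step] along one chain, with [P] standing for the product over the preceding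
    chains. *)
Lemma block_kill P i : (0 < i <= n)%N -> (forall z, earlier i z -> P * z = 0) ->
  forall k, (i + k <= (n.*2 - i).+1)%N ->
  forall z, earlier i z \/ in_block i (i + k) z ->
  P * \prod_(i <= m < i + k) rootv i m ^+ l.-1 * z = 0.
Proof.
move=> i_n PJ; have /andP[i0 i_n'] := i_n.
elim=> [|k IH] ik z Sz.
  rewrite addn0 big_geq // mulr1; apply: PJ.
  by case: Sz => // -[m /and3P[]]; lia.
rewrite addnS big_nat_recr /=; last by lia.
rewrite mulrA; pose S x := earlier i x \/ in_block i (i + k) x.
apply: (@kill_step _ _ S) => //.
- by apply: rootv_nil; lia.
- by apply: IH; lia.
- move=> y [Jy|[m /and3P[im mk mi] ->]].
    apply: (@rideal_sub _ _ (earlier i)); first by left.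
    by apply: earlier_rootv; [|lia|lia|exact: rideal_mem].
  apply: (@rideal_sub _ _ (in_block i (i + k))); first by right.
  by apply: in_block_rootv => //; lia.
case: Sz => [Jz|[m /and3P[im mk mi] ->]]; first by left; left.
have [mE|mE] := eqVneq m (i + k)%N; first by right; rewrite mE.
by left; right; exists m => //; apply/and3P; split=> //; lia.
Qed.

Lemma prod_kill i : (i <= n)%N -> forall z, earlier i.+1 z ->
  (\prod_(1 <= i' < i.+1) \prod_(i' <= m < (n.*2 - i').+1) rootv i' m ^+ l.-1) * z = 0.
Proof.
elim: i => [|i IH] i_n z Jz; first by case: Jz => i' [m /and4P[]]; lia.
rewrite big_nat_recr //=.
have -> : (n.*2 - i.+1).+1 = (i.+1 + ((n.*2 - i.+1).+1 - i.+1))%N by lia.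
apply: block_kill; [lia|by apply: IH; lia|lia|].
case: Jz => i' [m /and4P[i'0 i'i i'm mi'] ->].
have [iE|iE] := eqVneq i' i.+1; [right|left].
  by rewrite iE in i'0 i'i i'm mi' *; exists m => //; apply/and3P; split=> //; lia.
by exists i', m => //; apply/and4P; split=> //; lia.
Qed.

Lemma top_mul_e j : (0 < j <= n)%N ->
  (\prod_(1 <= i < n.+1) \prod_(i <= m < (n.*2 - i).+1) rootv i m ^+ l.-1) * e j = 0.
Proof.
move=> /andP[j0 jn]; apply: prod_kill => //; exists j, j; last by rewrite rootv_diag.
by apply/and4P; split=> //; lia.
Qed.

End Chain.

(** * The quotient algebra *)

HB.instance Definition _ (K : Type) n := gen_eqMixin (term K n).
HB.instance Definition _ (K : Type) n := gen_choiceMixin (term K n).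

Section Quotient.
Variables (K : fieldType) (n : nat) (r s : K) (l : nat).
Local Notation T := (term K n).
Local Notation "a ~ b" := (@ueq K n r s l.+1 a b) (at level 70).

Definition uequiv (a b : T) : bool := `[< a ~ b >].

Lemma uequiv_refl : reflexive uequiv.
Proof. by move=> a; apply/asboolP; constructor. Qed.
Lemma uequiv_sym : symmetric uequiv.
Proof. by move=> a b; apply/asboolP/asboolP; apply: ueq_sym. Qed.
Lemma uequiv_trans : transitive uequiv.
Proof. by move=> b a c /asboolP ab /asboolP bc; apply/asboolP; apply: ueq_trans bc. Qed.

Canonical uequiv_equiv := EquivRel uequiv uequiv_refl uequiv_sym uequiv_trans.

Definition ualg := {eq_quot uequiv}%qT.
HB.instance Definition _ := Choice.on ualg.
HB.instance Definition _ := EqQuotient.on ualg.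

Definition cls (a : T) : ualg := \pi_ualg%qT a.

Lemma clsP a b : cls a = cls b <-> a ~ b.
Proof.
by split=> [/eqP|ab]; [rewrite eqmodE => /asboolP | apply/eqP; rewrite eqmodE; apply/asboolP].
Qed.

Lemma cls_ind (P : ualg -> Prop) : (forall a, P (cls a)) -> forall x, P x.
Proof. by move=> H x; rewrite -[x]reprK; apply: H. Qed.

Lemma repr_cls a : repr (cls a) ~ a.
Proof. by apply/clsP; rewrite /cls reprK. Qed.

Definition uadd (x y : ualg) : ualg := cls (tadd (repr x) (repr y)).
Definition umul (x y : ualg) : ualg := cls (tmul (repr x) (repr y)).
Definition uopp (x : ualg) : ualg := cls (tscale (-1) (repr x)).
Definition usc (c : K) (x : ualg) : ualg := cls (tscale c (repr x)).

Lemma clsD a b : cls (tadd a b) = uadd (cls a) (cls b).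
Proof. by apply/clsP; apply: ueq_sym; apply: ueq_add; apply: repr_cls. Qed.
Lemma clsM a b : cls (tmul a b) = umul (cls a) (cls b).
Proof. by apply/clsP; apply: ueq_sym; apply: ueq_mul; apply: repr_cls. Qed.
Lemma clsZ c a : cls (tscale c a) = usc c (cls a).
Proof.
apply/clsP; apply: ueq_sym; apply: ueq_mul; first exact: ueq_refl.
exact: repr_cls.
Qed.
Lemma clsN a : cls (tscale (-1) a) = uopp (cls a).
Proof. exact: clsZ. Qed.

Lemma uaddA : associative uadd.
Proof.
elim/cls_ind=> a; elim/cls_ind=> b; elim/cls_ind=> c.
by rewrite -!clsD; apply/clsP/ueq_addA.
Qed.
Lemma uaddC : commutative uadd.
Proof. by elim/cls_ind=> a; elim/cls_ind=> b; rewrite -!clsD; apply/clsP/ueq_addC. Qed.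
Lemma uadd0 : left_id (cls (tsc 0)) uadd.
Proof. by elim/cls_ind=> a; rewrite -clsD; apply/clsP/ueq_add0. Qed.
Lemma uaddN : left_inverse (cls (tsc 0)) uopp uadd.
Proof. by elim/cls_ind=> a; rewrite -clsN uaddC -clsD; apply/clsP/ueq_addN. Qed.

HB.instance Definition _ := GRing.isZmodule.Build ualg uaddA uaddC uadd0 uaddN.

Lemma umulA : associative umul.
Proof.
elim/cls_ind=> a; elim/cls_ind=> b; elim/cls_ind=> c.
by rewrite -!clsM; apply/clsP/ueq_mulA.
Qed.
Lemma umul1l : left_id (cls (tsc 1)) umul.
Proof. by elim/cls_ind=> a; rewrite -clsM; apply/clsP/ueq_mul1l. Qed.
Lemma umul1r : right_id (cls (tsc 1)) umul.
Proof. by elim/cls_ind=> a; rewrite -clsM; apply/clsP/ueq_mul1r. Qed.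
Lemma umulDl : left_distributive umul +%R.
Proof.
elim/cls_ind=> a; elim/cls_ind=> b; elim/cls_ind=> c.
by rewrite -[_ + _]clsD -!clsM -[_ + _]clsD; apply/clsP/ueq_mulDl.
Qed.
Lemma umulDr : right_distributive umul +%R.
Proof.
elim/cls_ind=> a; elim/cls_ind=> b; elim/cls_ind=> c.
by rewrite -[cls b + _]clsD -!clsM -[_ + _]clsD; apply/clsP/ueq_mulDr.
Qed.

(** * The counit is well defined on the quotient *)

Lemma eps_gen1 k i : inrange n i ->
  eps (gen1 K n k i) = match k with KE | KF => 0 | _ => 1 end.
Proof.
rewrite /inrange => /andP[i0 i_n]; rewrite /gen1.
by case: insubP => [j _ _ //|]; rewrite prednK // i_n.
Qed.

Lemma eps_e i : eps (e K n i) = 0.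
Proof. by rewrite /e /gen1; case: insub. Qed.
Lemma eps_f i : eps (f K n i) = 0.
Proof. by rewrite /f /gen1; case: insub. Qed.

Lemma eps_tpow (a : T) k : eps (tpow a k) = eps a ^+ k.
Proof. by elim: k => //= k ->; rewrite exprS. Qed.

Lemma eps_Eij i j : eps (Eij n r i j) = 0.
Proof. by rewrite /Eij; case: (j - i)%N => [|k] /=; rewrite eps_e // !(mul0r, mulr0, addr0). Qed.
Lemma eps_Epr i j : eps (Epr n r s i j) = 0.
Proof. by rewrite /Epr; case: (n - j)%N => [|k] /=; rewrite eps_e // !(mul0r, mulr0, addr0). Qed.
Lemma eps_Fij i j : eps (Fij n s i j) = 0.
Proof. by rewrite /Fij; case: (j - i)%N => [|k] /=; rewrite eps_f // !(mul0r, mulr0, addr0). Qed.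
Lemma eps_Fpr i j : eps (Fpr n r s i j) = 0.
Proof. by rewrite /Fpr; case: (n - j)%N => [|k] /=; rewrite eps_f // !(mul0r, mulr0, addr0). Qed.

Lemma eps_defrel (a b : T) : defrel r s l.+1 a b -> eps a = eps b.
Proof.
have serre_pos i j : exists k, serre_exp n i j = k.+1.
  by rewrite /serre_exp; case: ifP => _; [exists 2|case: ifP => _; [exists 1%N|exists 0%N]].
case=> [i|i|i|i|i j|i j|i j|i j|i j|i j|i j|i j|i j|i j|i j|i j|i j|i j|i|i] *.
all: rewrite ?eps_tpow ?eps_Eij ?eps_Epr ?eps_Fij ?eps_Fpr ?exprS ?mul0r //.
all: try by rewrite /= !eps_gen1 // ?(mulr0, mulr1, mul0r).
- rewrite /= eps_e eps_f; case: ifP => _ /=; rewrite ?eps_gen1 //.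
    by rewrite !(mulr0, mulr1) subrr mulr0 addr0.
  by rewrite !mulr0 addr0.
- by have [k ->] := serre_pos i j; rewrite iterS /= eps_e !(mul0r, mulr0, addr0).
- by have [k ->] := serre_pos i j; rewrite iterS /= eps_f !(mul0r, mulr0, addr0).
- by rewrite eps_gen1 // expr1n mulr1.
- by rewrite eps_gen1 // expr1n mulr1.
Qed.

Lemma eps_ueq (a b : T) : a ~ b -> eps a = eps b.
Proof.
elim=> //=; try by [congruence].
- by move=> *; rewrite addrA.
- by move=> *; rewrite addrC.
- by move=> *; rewrite add0r.
- by move=> *; rewrite mulN1r subrr.
- by move=> *; rewrite mulrA.
- by move=> *; rewrite mul1r.
- by move=> *; rewrite mulr1.
- by move=> *; rewrite mulrDl.
- by move=> *; rewrite mulrDr.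
- by move=> *; rewrite mulrC.
- exact: eps_defrel.
Qed.

(* An [algType] must be nontrivial; the counit ensures this when the exponent is
   positive, which is why it is written [l.+1] in this section. *)
Lemma uone_neq0 : cls (tsc 1) != 0.
Proof. by apply/eqP => /clsP/eps_ueq/eqP; rewrite /= oner_eq0. Qed.

HB.instance Definition _ := GRing.Zmodule_isNzRing.Build ualg
  umulA umul1l umul1r umulDl umulDr uone_neq0.

Lemma clsC c d : cls (tsc (c * d)) = umul (cls (tsc c)) (cls (tsc d)).
Proof. by rewrite -clsM; apply/clsP/ueq_sym/ueq_scM. Qed.

Lemma uscE c x : usc c x = cls (tsc c) * x.
Proof. by elim/cls_ind: x => a; rewrite -clsZ -[_ * _]clsM. Qed.

Lemma uscA c d x : usc c (usc d x) = usc (c * d) x.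
Proof. by rewrite !uscE clsC mulrA. Qed.
Lemma usc1 : left_id 1 usc.
Proof. by move=> x; rewrite uscE; apply: mul1r. Qed.
Lemma uscDr : right_distributive usc +%R.
Proof. by move=> c x y; rewrite !uscE mulrDr. Qed.
Lemma uscDl x : {morph usc^~ x : c d / c + d}.
Proof.
move=> c d; rewrite !uscE -mulrDl; congr (_ * _).
by rewrite -[cls _ + _]clsD; apply/clsP/ueq_sym/ueq_scD.
Qed.

HB.instance Definition _ := GRing.Zmodule_isLmodule.Build K ualg uscA usc1 uscDr uscDl.

Lemma uscaleE c (x : ualg) : c *: x = cls (tsc c) * x.
Proof. exact: uscE. Qed.

Lemma uscAl c (x y : ualg) : c *: (x * y) = (c *: x) * y.
Proof. by rewrite !uscaleE mulrA. Qed.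

HB.instance Definition _ := GRing.Lmodule_isLalgebra.Build K ualg uscAl.

Lemma uscAr c (x y : ualg) : c *: (x * y) = x * (c *: y).
Proof.
rewrite !uscaleE !mulrA; congr (_ * _).
by elim/cls_ind: x => a; rewrite -![_ * _]clsM; apply/clsP/ueq_scC.
Qed.

HB.instance Definition _ := GRing.Lalgebra_isAlgebra.Build K ualg uscAr.

Lemma cls_add a b : cls (tadd a b) = cls a + cls b. Proof. exact: clsD. Qed.
Lemma cls_mul a b : cls (tmul a b) = cls a * cls b. Proof. exact: clsM. Qed.
Lemma cls_scale c a : cls (tscale c a) = c *: cls a. Proof. exact: clsZ. Qed.
Lemma cls_sub a b : cls (tsub a b) = cls a - cls b.
Proof. by rewrite /tsub cls_add cls_scale scaleN1r. Qed.
Lemma cls_pow a k : cls (tpow a k) = cls a ^+ k.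
Proof. by elim: k => //= k IH; rewrite cls_mul IH exprS. Qed.
Lemma cls_prod xs : cls (tprod xs) = \prod_(x <- xs) cls x.
Proof. by elim: xs => [|x xs IH]; rewrite ?big_nil // big_cons -IH -cls_mul. Qed.
Lemma cls_sum xs : cls (tsum xs) = \sum_(x <- xs) cls x.
Proof. by elim: xs => [|x xs IH]; rewrite ?big_nil // big_cons -IH -cls_add. Qed.
Lemma cls_rel a b : defrel r s l.+1 a b -> cls a = cls b.
Proof. by move=> H; apply/clsP/ueq_rel. Qed.

End Quotient.

(** * The Borel subalgebra *)

Section Borel.
Variables (K : fieldType) (n : nat) (r s : K) (l : nat).
Hypotheses (r0 : r != 0) (s0 : s != 0) (rs2 : r * r + s * s != 0).
Hypothesis rs3 : r * r + r * s + s * s != 0.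
Local Notation A := (ualg K n r s l).
Local Notation cls := (cls K n r s l).
Local Notation E i := (cls (e K n i)).
Local Notation W i := (cls (w K n i)).
Local Notation Wi i := (cls (wi K n i)).

Lemma clsW i : inrange n i -> W i * Wi i = 1.
Proof. by move=> Hi; rewrite -cls_mul (cls_rel _ _ _ _ _ _ _ (R_wwi _ _ _ Hi)). Qed.

Lemma clsWi i : inrange n i -> Wi i * W i = 1.
Proof. by move=> Hi; rewrite -cls_mul (cls_rel _ _ _ _ _ _ _ (R_wiw _ _ _ Hi)). Qed.

Lemma clsWW i j : inrange n i -> inrange n j -> GRing.comm (W i) (W j).
Proof.
by move=> Hi Hj; rewrite /GRing.comm -!cls_mul (cls_rel _ _ _ _ _ _ _ (R_ww _ _ _ Hi Hj)).
Qed.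

Lemma clsWl i : inrange n i -> W i ^+ l.+1 = 1.
Proof. by move=> Hi; rewrite -cls_pow (cls_rel _ _ _ _ _ _ _ (R_wl _ _ _ Hi)). Qed.

Lemma clsWEWi i j : inrange n i -> inrange n j ->
  W j * E i * Wi j = pair_ij n r s i j *: E i.
Proof.
move=> Hi Hj; rewrite -!cls_mul (cls_rel _ _ _ _ _ _ _ (R_we _ _ _ Hi Hj)).
by rewrite cls_scale.
Qed.

Lemma clsWE i j : inrange n i -> inrange n j ->
  W j * E i = pair_ij n r s i j *: (E i * W j).
Proof. by move=> Hi Hj; rewrite scalerAl -clsWEWi // -[RHS]mulrA clsWi // mulr1. Qed.

(** Each iterate is a weight vector for conjugation by ω_i, and its weight is the parameter of the
    next q-bracket. The two claims are therefore proved together. *)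
Lemma iter_adl i j k : inrange n i -> inrange n j ->
  W i * cls (iter k (adl_e i) (e K n j)) * Wi i =
    (pair_ij n r s i i ^+ k * pair_ij n r s j i) *: cls (iter k (adl_e i) (e K n j)) /\
  cls (iter k.+1 (adl_e i) (e K n j)) =
    qbr (pair_ij n r s i i ^+ k * pair_ij n r s j i) (E i)
        (cls (iter k (adl_e i) (e K n j))).
Proof.
move=> Hi Hj.
have adlE b c : W i * cls b * Wi i = c *: cls b -> cls (adl_e i b) = qbr c (E i) (cls b).
  by move=> Eb; rewrite /adl_e cls_sub !cls_mul Eb /qbr scalerAl.
elim: k => [|k [IH1 IH2]].
  rewrite expr0 mul1r /=; have H := clsWEWi j i Hj Hi.
  by split=> //; apply: adlE.
suff H : W i * cls (iter k.+1 (adl_e i) (e K n j)) * Wi i =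
    (pair_ij n r s i i ^+ k.+1 * pair_ij n r s j i) *: cls (iter k.+1 (adl_e i) (e K n j)).
  by split=> //; apply: adlE.
rewrite IH2 exprS -[_ * _ ^+ k * _]mulrA /qbr.
set B := cls (iter k _ _) in IH1 *; set c := (_ ^+ k * _) in IH1 *.
have HW x y : W i * (x * y) * Wi i = (W i * x * Wi i) * (W i * y * Wi i).
  by rewrite !mulrA -(mulrA (W i * x) (Wi i)) clsWi // mulr1.
rewrite mulrBr mulrBl -scalerAr -scalerAl !HW IH1 clsWEWi //.
rewrite -!scalerAl -!scalerAr !scalerA scalerBr !scalerA.
by congr (_ *: _ - _ *: _); ring.
Qed.

Lemma serre_rel i j : inrange n i -> inrange n j -> i != j ->
  cls (iter (serre_exp n i j) (adl_e i) (e K n j)) = 0.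
Proof. by move=> Hi Hj ij; rewrite (cls_rel _ _ _ _ _ _ _ (R_serre_e _ _ _ Hi Hj ij)). Qed.

Lemma adl1 i j : inrange n i -> inrange n j ->
  cls (iter 1 (adl_e i) (e K n j)) = qbr (pair_ij n r s j i) (E i) (E j).
Proof. by move=> Hi Hj; rewrite (iter_adl i j 0 Hi Hj).2 mul1r. Qed.

Lemma adl2 i j : inrange n i -> inrange n j ->
  cls (iter 2 (adl_e i) (e K n j)) =
  qbr (pair_ij n r s i i * pair_ij n r s j i) (E i)
    (qbr (pair_ij n r s j i) (E i) (E j)).
Proof. by move=> Hi Hj; rewrite (iter_adl i j 1 Hi Hj).2 adl1. Qed.

Lemma adl3 i j : inrange n i -> inrange n j ->
  cls (iter 3 (adl_e i) (e K n j)) =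
  qbr (pair_ij n r s i i ^+ 2 * pair_ij n r s j i) (E i)
    (qbr (pair_ij n r s i i * pair_ij n r s j i) (E i)
      (qbr (pair_ij n r s j i) (E i) (E j))).
Proof. by move=> Hi Hj; rewrite (iter_adl i j 2 Hi Hj).2 adl2. Qed.

Lemma E_far i j : (0 < i)%N -> (i.+1 < j)%N -> (j <= n)%N -> GRing.comm (E i) (E j).
Proof.
move=> i0 ij jn.
have Hi : inrange n i by rewrite /inrange; lia.
have Hj : inrange n j by rewrite /inrange; lia.
have := serre_rel i j Hi Hj ltac:(lia).
have -> : serre_exp n i j = 1%N by rewrite /serre_exp !ifF //; lia.
rewrite adl1 // /pair_ij !ifF; [|lia..].
by rewrite /qbr scale1r => /subr0_eq.
Qed.

Lemma E_serre_right i : (0 < i)%N -> (i < n)%N ->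
  qbr (s * s) (E i) (qbr (r * r) (E i) (E i.+1)) = 0.
Proof.
move=> i0 i_n.
have Hi : inrange n i by rewrite /inrange; lia.
have Hj : inrange n i.+1 by rewrite /inrange; lia.
have := serre_rel i i.+1 Hi Hj ltac:(lia).
have -> : serre_exp n i i.+1 = 2 by rewrite /serre_exp ifF ?ifT //; lia.
rewrite adl2 //.
have -> : pair_ij n r s i i = r ^+ 2 / s ^+ 2 by rewrite /pair_ij eqxx ifF //; lia.
have -> : pair_ij n r s i.+1 i = s ^+ 2.
  by rewrite /pair_ij (gtn_eqF (ltnSn i)) (ltn_eqF (_ : i < i.+2)%N) // eqxx.
(* The inner parameter is s^2 and the outer one r^2 s^-2 s^2 = r^2, the opposite of the stated
   order. *)
rewrite divfK ?expf_neq0 // => <-.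
by rewrite qbr_swapr !expr2.
Qed.

Lemma E_serre_left i : (0 < i)%N -> (i.+1 < n)%N ->
  qbr (s * s) (qbr (r * r) (E i) (E i.+1)) (E i.+1) = 0.
Proof.
move=> i0 i_n.
have Hi : inrange n i by rewrite /inrange; lia.
have Hj : inrange n i.+1 by rewrite /inrange; lia.
have := serre_rel i.+1 i Hj Hi ltac:(lia).
have -> : serre_exp n i.+1 i = 2.
  by rewrite /serre_exp ifF ?ifT //; lia.
rewrite adl2 //.
have -> : pair_ij n r s i.+1 i.+1 = r ^+ 2 / s ^+ 2 by rewrite /pair_ij eqxx ifF //; lia.
have -> : pair_ij n r s i i.+1 = (r * r)^-1.
  by rewrite /pair_ij ifF ?eqxx ?expr2 //; lia.
have -> : r ^+ 2 / s ^+ 2 / (r * r) = (s * s)^-1 by field; rewrite r0 s0.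
rewrite (qbr_flip _ _ (r * r)) ?mulf_neq0 // qbrZl (qbr_flip _ _ (s * s)) ?mulf_neq0 //.
by move=> ->; rewrite !scaler0.
Qed.

Lemma E_serre_short i : (0 < i)%N -> i.+1 = n ->
  qbr (s * s) (qbr (r * s) (qbr (r * r) (E i) (E n)) (E n)) (E n) = 0.
Proof.
move=> i0 i_n.
have Hi : inrange n i by rewrite /inrange; lia.
have Hj : inrange n n by rewrite /inrange; lia.
have := serre_rel n i Hj Hi ltac:(lia).
have -> : serre_exp n n i = 3 by rewrite /serre_exp eqxx ifT //; lia.
rewrite adl3 //.
have -> : pair_ij n r s n n = r / s by rewrite /pair_ij !eqxx.
have -> : pair_ij n r s i n = (r * r)^-1.
  by rewrite /pair_ij ifF ?ifT ?expr2 //; lia.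
(* The parameters (r/s)^k r^-2 for k = 0, 1, 2 are the inverses of r^2, r s and s^2; flipping all
   three brackets gives the stated form. *)
have -> : (r / s) ^+ 2 / (r * r) = (s * s)^-1 by field; rewrite r0 s0.
have -> : r / s / (r * r) = (r * s)^-1 by field; rewrite r0 s0.
rewrite (qbr_flip _ _ (r * r)) ?mulf_neq0 // !qbrZl.
rewrite (qbr_flip _ _ (r * s)) ?mulf_neq0 // !qbrZl.
rewrite (qbr_flip _ _ (s * s)) ?mulf_neq0 //.
by move=> ->; rewrite !scaler0.
Qed.

(** * Identification of the root vectors and of x with the chains *)

Local Notation V := (rootv K A n r s (fun i => E i)).

Lemma cls_Eij i j : (0 < i)%N -> (i <= j <= n)%N -> cls (Eij n r i j) = V i j.
Proof.
rewrite /Eij => i0 /andP[ij]; rewrite -{1 3}(subnKC ij).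
move: (j - i)%N => k {j ij}; elim: k i i0 => [|k IH] i i0 ik /=; first by rewrite addn0 rootv_diag.
rewrite cls_sub !cls_mul -uscaleE IH //; last by lia.
rewrite -addSnnS (rootv_left _ _ _ _ _ _ E_far i) //; last by lia.
by rewrite /qbr expr2 -scalerAl.
Qed.

Lemma cls_Epr i j : (0 < i)%N -> (i < j <= n)%N ->
  cls (Epr n r s i j) = V i (n.*2 - j).+1.
Proof.
rewrite /Epr => i0 /andP[ij jn].
have -> : (n.*2 - j).+1 = (n.+1 + (n - j))%N by lia.
have: (n - j < n - i)%N by lia.
elim: (n - j)%N => [|k IH] kn; rewrite [Epr_aux _ _ _ _ _]/= cls_sub !cls_mul -uscaleE.
  by rewrite addn0 rootv_top ?cls_Eij // /qbr -?scalerAl //; lia.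
rewrite IH ?addnS; last by lia.
rewrite rootv_desc; [|lia|lia].
have -> : (n.*2 - (n.+1 + k))%N = (n - k.+1)%N by lia.
by rewrite /qbr expr2 -scalerAl.
Qed.

Lemma V_nil i m : (0 < i)%N -> (i <= m)%N -> (m <= n.*2 - i)%N -> V i m ^+ l.+1 = 0.
Proof.
move=> i0 im mi; have [mn|nm] := leqP m n.
  rewrite -cls_Eij ?im // -cls_pow (cls_rel _ _ _ _ _ _ _ (R_Eij r s l.+1 _ mn)) //.
  by rewrite i0.
have -> : m = (n.*2 - (n.*2 - m).+1).+1 by lia.
have Hn : ((n.*2 - m).+1 <= n)%N by lia.
have Hi : (0 < i < (n.*2 - m).+1)%N by lia.
rewrite -cls_Epr //; last by lia.
by rewrite -cls_pow (cls_rel _ _ _ _ _ _ _ (R_Epr r s l.+1 Hi Hn)).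
Qed.

(** The primed indices n, ..., i + 1 are the positions n + 1, ..., 2n - i in increasing order. *)
Lemma rev_iota_map (T : Type) (g : nat -> T) i : (i <= n)%N ->
  [seq g (n.*2 - j).+1 | j <- rev (iota i.+1 (n - i))] = [seq g m | m <- iota n.+1 (n - i)].
Proof.
move=> i_n; apply: (@eq_from_nth _ (g 0%N)); rewrite !size_map size_rev !size_iota //.
move=> k kn; rewrite !(nth_map 0%N) ?size_rev ?size_iota //.
rewrite nth_rev ?size_iota // !nth_iota //; last by lia.
by congr g; lia.
Qed.

Lemma cls_Ehat i : (0 < i <= n)%N ->
  cls (Ehat n r s l.+1 i) = \prod_(i <= m < (n.*2 - i).+1) V i m ^+ l.
Proof.
move=> /andP[i0 i_n]; rewrite /Ehat cls_mul !cls_prod !big_map /index_iota.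
have -> : ((n.*2 - i).+1 - i = (n - i).+1 + (n - i))%N by lia.
rewrite iotaD big_cat /=; congr (_ * _).
  rewrite -/(iota i (n - i).+1) !big_seq; apply: eq_bigr => j.
  by rewrite mem_iota => Hj; rewrite cls_pow cls_Eij //; lia.
have -> : (i + (n - i).+1)%N = n.+1 by lia.
rewrite -(big_map (V i) xpredT (fun x => x ^+ l)) -rev_iota_map // big_map.
rewrite !big_seq; apply: eq_bigr => j.
by rewrite mem_rev mem_iota => Hj; rewrite cls_pow cls_Epr //; lia.
Qed.

Lemma cls_xelt :
  cls (xelt n r s l.+1) =
  \prod_(1 <= i < n.+1) \prod_(i <= m < (n.*2 - i).+1) V i m ^+ l.
Proof.
rewrite /xelt cls_prod big_map /index_iota subn1 /= !big_seq.
by apply: eq_bigr => i; rewrite mem_iota => Hi; apply: cls_Ehat; lia.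
Qed.

Lemma xelt_e j : inrange n j -> cls (xelt n r s l.+1) * E j = 0.
Proof.
move=> Hj; rewrite cls_xelt.
apply: (top_mul_e _ _ _ _ _ _ E_far r0 s0 rs2 rs3 E_serre_right E_serre_left
  E_serre_short l.+1 (ltn0Sn l) V_nil _ Hj).
Qed.

(** * The factor t and its products with the generators *)

Definition geomW i : A := \sum_(k <- iota 0 l.+1) W i ^+ k.

Lemma cls_telt : cls (telt K n l.+1) = \prod_(i <- iota 1 n) geomW i.
Proof.
rewrite /telt cls_prod big_map; apply: eq_bigr => i _.
by rewrite cls_sum big_map; apply: eq_bigr => k _; rewrite cls_pow.
Qed.

Lemma geomW_w i : inrange n i -> geomW i * W i = geomW i.
Proof.
move=> Hi; rewrite /geomW -[iota _ _]/(index_iota 0 l.+1) mulr_suml.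
under eq_bigr do rewrite -exprSr.
by rewrite big_nat_recr // [RHS]big_nat_recl //= clsWl // addrC expr0.
Qed.

Lemma telt_w j : inrange n j -> cls (telt K n l.+1) * W j = cls (telt K n l.+1).
Proof.
move=> Hj; rewrite cls_telt.
have: j \in iota 1 n by rewrite mem_iota; move: Hj; rewrite /inrange; lia.
have: {subset iota 1 n <= inrange n} by move=> i; rewrite mem_iota /inrange /in_mem /=; lia.
elim: (iota 1 n) => //= i u IH Hu; rewrite in_cons !big_cons.
have Hi : inrange n i by apply: (Hu i); rewrite mem_head.
have Hu' : {subset u <= inrange n} by move=> x xu; apply: Hu; rewrite in_cons xu orbT.
have [ju _|ju] := boolP (j \in u); first by rewrite -mulrA IH.
rewrite orbF => /eqP jE; rewrite -mulrA.
suff C : GRing.comm (\prod_(i' <- u) geomW i') (W j) by rewrite C mulrA jE geomW_w.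
apply: commr_sym; rewrite big_seq; apply: commr_prod => k ku.
apply: commr_sum => m _; apply: commrX; apply: clsWW => //; exact: Hu'.
Qed.

Lemma telt_wi j : inrange n j -> cls (telt K n l.+1) * Wi j = cls (telt K n l.+1).
Proof. by move=> Hj; rewrite -{1}(telt_w j Hj) -mulrA clsW // mulr1. Qed.

Lemma telt_e j : inrange n j -> exists t, cls (telt K n l.+1) * E j = E j * t.
Proof.
move=> Hj; rewrite cls_telt.
have: {subset iota 1 n <= inrange n} by move=> i; rewrite mem_iota /inrange /in_mem /=; lia.
elim: (iota 1 n) => [|i u IH] Hu; first by exists 1; rewrite big_nil mul1r mulr1.
have Hi : inrange n i by apply: (Hu i); rewrite mem_head.
have [|t Ht] := IH; first by move=> x xu; apply: Hu; rewrite in_cons xu orbT.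
have [t' Ht'] : exists t', geomW i * E j = E j * t'.
  (* The same geometric sum with ω_i scaled by the factor it acquires on passing e_j. *)
  exists (\sum_(k <- iota 0 l.+1) pair_ij n r s j i ^+ k *: W i ^+ k).
  rewrite /geomW mulr_suml mulr_sumr; apply: eq_bigr => k _.
  elim: k => [|k IHk]; first by rewrite !expr0 scale1r mul1r mulr1.
  rewrite exprS -mulrA IHk -!scalerAr mulrA clsWE // -!scalerAl scalerA -mulrA.
  by rewrite -exprS -exprSr.
exists (t' * t); by rewrite big_cons -mulrA Ht !mulrA Ht'.
Qed.

Lemma gen1_ord k (j : 'I_n) : gen1 K n k j.+1 = tgen K k j.
Proof. by rewrite /gen1 /= valK. Qed.

Lemma yprime_integral b : in_borel b ->
  cls (yprime n r s l.+1) * cls b = eps b *: cls (yprime n r s l.+1).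
Proof.
have Hin (j : 'I_n) : inrange n j.+1 by rewrite /inrange /=.
elim: b => [k j|c|a IHa b IHb|a IHa b IHb] /=.
- rewrite -gen1_ord /yprime cls_mul; case: k => // _.
  + have [t Ht] := telt_e _ (Hin j).
    by rewrite -mulrA Ht mulrA xelt_e // mul0r scale0r.
  + by rewrite -mulrA telt_w // scale1r.
  + by rewrite -mulrA telt_wi // scale1r.
- by move=> _; rewrite uscaleE -!cls_mul; apply/clsP/ueq_sym/ueq_scC.
- by move=> /andP[/IHa Ea /IHb Eb]; rewrite cls_add mulrDr Ea Eb scalerDl.
- by move=> /andP[/IHa Ea /IHb Eb]; rewrite cls_mul mulrA Ea -scalerAl Eb scalerA.
Qed.

End Borel.

(** * The right integral at roots of unity *)

Theorem theorem7p2 (K : fieldExtType rat) (r s : K) (d d' n : nat) :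
  (<<1%VS & [:: r; s]>>)%VS = fullv ->
  d.-primitive_root r -> d'.-primitive_root s ->
  r ^+ 3 != s ^+ 3 -> r ^+ 4 != s ^+ 4 -> odd (lcmn d d') -> (2 <= n)%N ->
  forall b : term K n, in_borel b ->
    @ueq K n r s (lcmn d d')
      (tmul (@yprime K n r s (lcmn d d')) b)
      (tmul (tsc (eps b)) (@yprime K n r s (lcmn d d'))).
Proof.
move=> _ rd sd rs3 rs4 _ _ b Hb.
have root_neq0 k (z : K) : k.-primitive_root z -> z != 0.
  move=> zk; apply/eqP => z0; have := prim_expr_order zk.
  by rewrite z0 expr0n gtn_eqF ?(prim_order_gt0 zk) // => /esym/eqP; rewrite oner_eq0.
have r0 := root_neq0 _ _ rd; have s0 := root_neq0 _ _ sd.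
have rs2 : r * r + s * s != 0.
  apply: contraNneq rs4 => H; rewrite -subr_eq0.
  have -> : r ^+ 4 - s ^+ 4 = (r * r + s * s) * (r * r - s * s) by ring.
  by rewrite H mul0r.
have rs1 : r * r + r * s + s * s != 0.
  apply: contraNneq rs3 => H; rewrite -subr_eq0.
  have -> : r ^+ 3 - s ^+ 3 = (r * r + r * s + s * s) * (r - s) by ring.
  by rewrite H mul0r.
have l0 : (0 < lcmn d d')%N by rewrite lcmn_gt0 (prim_order_gt0 rd) (prim_order_gt0 sd).
(* The positive exponent is written as a successor, the form in which the quotient algebra is
   built. *)
rewrite -(prednK l0); apply/(clsP K n r s (lcmn d d').-1).
by rewrite cls_mul yprime_integral // uscaleE cls_mul.
Qed.
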